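(* Let $T(z)=\prod_{j=0}^{\infty}(1-z^{2^j})$ and $M(z)=\sum_{j=0}^{\infty}\dfrac{(-1)^j z^{2^j}}{\prod_{i=0}^{j-1}(1-z^{2^i})}$ (power series converging for $|z|<1$). Then for every integer $b\ge2$, \[\mu\left(T\left(\tfrac1b\right),M\left(\tfrac1b\right)\right)\le\tfrac{32}{17}.\] Moreover, if $a/b\in\mathbb{Q}$ with $a,b$ integers, $b\ge2$, $\log|a|=\lambda\log b$ and $0\le\lambda<1/2$, then \[\mu\left(T\left(\tfrac ab\right),M\left(\tfrac ab\right)\right)\le\frac{32(1-\lambda)}{17-26\lambda}.\]
   Context: For real numbers $\alpha_1,\dots,\alpha_n$, the simultaneous approximation exponent $\mu(\alpha_1,\dots,\alpha_n)$ is the supremum of the real numbers $\mu$ such that the inequality $\max_{1\le i\le n}|\alpha_i-p_i/q|<q^{-\mu}$ has infinitely many solutions in rational numbers $p_i/q$ (with common denominator $q\ge1$). The series $M$ satisfies $M(z^2)=(z-1)(M(z)-z)$ and $T$ satisfies $T(z)=(1-z)T(z^2)$. *)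

(* Defs.v *)
From Stdlib Require Import Reals ZArith List.
From Coquelicot Require Import Coquelicot.
Open Scope R_scope.

Fixpoint Tprod (z : R) (n : nat) : R :=
  match n with
  | O => 1
  | S k => Tprod z k * (1 - z ^ (2 ^ k))
  end.

Definition T (z : R) : R := real (Lim_seq (Tprod z)).

Definition M_term (z : R) (j : nat) : R :=
  (-1) ^ j * z ^ (2 ^ j) / Tprod z j.

Definition M (z : R) : R := Series (M_term z).

Definition approx_sol (a1 a2 mu : R) (t : Z * Z * Z) : Prop :=
  let '(p1, p2, q) := t in
  (1 <= q)%Z /\
  Rmax (Rabs (a1 - IZR p1 / IZR q)) (Rabs (a2 - IZR p2 / IZR q))
    < Rpower (IZR q) (- mu).

Definition infinitely_many_sols (a1 a2 mu : R) : Prop :=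
  ~ (exists l : list (Z * Z * Z),
        forall t, approx_sol a1 a2 mu t -> In t l).

Definition sim_approx_exp (a1 a2 : R) : Rbar :=
  Lub_Rbar (fun mu => infinitely_many_sols a1 a2 mu).

(* Main.v *)
(* For integer polynomials A, B, C, a linear form R(w) = A(w) + B(w) T(w) + C(w) M(w) with an
   unusually high order of vanishing v at w = 0 is transported, through the functional equations
   and w = z^(2^k), to an integer form in 1, T(a/b), M(a/b) with coefficients O(b^(2^k d)) and
   value of exact size b^(2^k (d - v (1 - lam))).  Evaluate it at a very good approximation
   (q, p1, p2).  If the resulting integer is nonzero, the coefficients or q must be large.  If it
   is zero, the form itself is a small combination of the errors, so that
   max |alpha_i - p_i/q| >= c |z|^(2^k v).  Writing Y = log_b q, either case shows that each form
   excludes the interval 2^k v (1 - lam) / mu < Y < 2^k (v (1 - lam) - d), up to constants.  For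
   mu > 32 (1 - lam) / (17 - 26 lam) the intervals of the forms (d, v) = (2, 8), (7, 21),
   (18, 52), used at levels k + 2, k + 1, k, overlap and cover a full octave of Y. *)
Require Import Defs.
From Stdlib Require Import Reals ZArith List Lra Lia Psatz.
From Coquelicot Require Import Coquelicot.
Import ListNotations.
Open Scope R_scope.

(** * Powers with exponent 2^k *)

Lemma pow_two_S (z : R) (k : nat) : z ^ (2 ^ S k) = (z ^ 2 ^ k) ^ 2.
Proof. rewrite <- pow_mult. f_equal. simpl; lia. Qed.

Lemma pow_two_sqr (z : R) (k : nat) : (z ^ 2) ^ 2 ^ k = z ^ 2 ^ S k.
Proof. rewrite <- pow_mult. f_equal. Qed.

Lemma lt_pow_two (k : nat) : (k < 2 ^ k)%nat.
Proof. apply Nat.pow_gt_lin_r; lia. Qed.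

Lemma pow_le_anti (r : R) (m n : nat) : 0 <= r <= 1 -> (m <= n)%nat -> r ^ n <= r ^ m.
Proof.
  intros Hr Hmn. replace n with (m + (n - m))%nat by lia. rewrite pow_add.
  rewrite <- (Rmult_1_r (r ^ m)) at 2. apply Rmult_le_compat_l.
  - apply pow_le; lra.
  - rewrite <- (pow1 (n - m)). apply pow_incr; lra.
Qed.

Lemma Rabs_pow_lt1 (z : R) (n : nat) : Rabs z < 1 -> (0 < n)%nat -> Rabs (z ^ n) < 1.
Proof.
  intros Hz Hn. rewrite <- RPow_abs.
  apply pow_lt_1_compat; [split; [apply Rabs_pos | exact Hz] | lia].
Qed.

Lemma one_sub_pow_neq0 (z : R) (k : nat) : Rabs z < 1 -> 1 - z ^ 2 ^ k <> 0.
Proof.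
  intros Hz. pose proof (Rabs_pow_lt1 z (2 ^ k) Hz ltac:(pose proof (lt_pow_two k); lia)) as H.
  apply Rabs_def2 in H. lra.
Qed.

(** * Estimates for the products, T and M near the origin *)

Lemma Tprod_neq0 (z : R) (n : nat) : Rabs z < 1 -> Tprod z n <> 0.
Proof.
  intros Hz. induction n as [|n IH]; simpl; [lra|].
  apply Rmult_integral_contrapositive_currified; auto using one_sub_pow_neq0.
Qed.

Lemma Tprod_sqr (z : R) (n : nat) : Tprod z (S n) = (1 - z) * Tprod (z ^ 2) n.
Proof.
  induction n as [|n IH]; [simpl; ring|].
  change (Tprod z (S (S n))) with (Tprod z (S n) * (1 - z ^ 2 ^ S n)).
  rewrite IH. simpl Tprod. rewrite <- (pow_two_sqr z n). simpl; ring.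
Qed.

(** With r = |z|, expanding the product bounds the difference by the product of the 1 + r^(2^j)
    minus 1. That product telescopes to (1 - r^(2^n)) / (1 - r), which gives the right-hand side. *)
Lemma Tprod_sub1_aux (z : R) (n : nat) : Rabs z < 1 ->
  Rabs (Tprod z n - 1) <= (Rabs z - Rabs z ^ 2 ^ n) / (1 - Rabs z).
Proof.
  intros Hz. induction n as [|n IH].
  - simpl. replace (1 - 1) with 0 by ring. rewrite Rabs_R0.
    replace (Rabs z - Rabs z * 1) with 0 by ring. unfold Rdiv; lra.
  - simpl Tprod.
    replace (Tprod z n * (1 - z ^ 2 ^ n) - 1)
      with ((Tprod z n - 1) * (1 - z ^ 2 ^ n) + - z ^ 2 ^ n) by ring.
    eapply Rle_trans; [apply Rabs_triang|].
    rewrite Rabs_mult, Rabs_Ropp, <- RPow_abs, pow_two_S.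
    assert (H1 : Rabs (1 - z ^ 2 ^ n) <= 1 + Rabs z ^ 2 ^ n).
    { rewrite RPow_abs. unfold Rminus. eapply Rle_trans; [apply Rabs_triang|].
      rewrite Rabs_R1, Rabs_Ropp. lra. }
    pose proof (pow_le (Rabs z) (2 ^ n) (Rabs_pos z)) as Hp.
    set (r := Rabs z) in *. set (p := r ^ 2 ^ n) in *.
    replace ((r - p ^ 2) / (1 - r)) with ((r - p) / (1 - r) * (1 + p) + p) by (field; lra).
    apply Rplus_le_compat_r. apply Rmult_le_compat; auto using Rabs_pos.
Qed.

Lemma Tprod_sub1 (z : R) (n : nat) : Rabs z < 1 ->
  Rabs (Tprod z n - 1) <= Rabs z / (1 - Rabs z).
Proof.
  intros Hz. eapply Rle_trans; [apply Tprod_sub1_aux, Hz|].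
  apply Rmult_le_compat_r; [left; apply Rinv_0_lt_compat; lra|].
  pose proof (pow_le (Rabs z) (2 ^ n) (Rabs_pos z)); lra.
Qed.

Lemma Tprod_sub1_small (z : R) (n : nat) : Rabs z <= 1 / 4 ->
  Rabs (Tprod z n - 1) <= 2 * Rabs z.
Proof.
  intros Hz. pose proof (Rabs_pos z). eapply Rle_trans; [apply Tprod_sub1; lra|].
  apply Rle_div_l; nra.
Qed.

Lemma Tprod_bounds (z : R) (n : nat) : Rabs z <= 1 / 4 -> 1 / 2 <= Tprod z n <= 3 / 2.
Proof.
  intros Hz. pose proof (Tprod_sub1_small z n Hz) as H.
  apply Rabs_le_between in H. lra.
Qed.

(** The denominator is at least 1/2, and 2^j >= j + 1 replaces the lacunary power by a geometric
    one, so that series of such terms can be compared with a geometric series. *)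
Lemma M_term_small (z : R) (j : nat) : Rabs z <= 1 / 4 ->
  Rabs (M_term z j) <= 2 * Rabs z * Rabs z ^ j.
Proof.
  intros Hz. unfold M_term. pose proof (Tprod_bounds z j Hz) as HT.
  pose proof (Rabs_pos z).
  unfold Rdiv. rewrite !Rabs_mult, pow_1_abs, Rmult_1_l, <- RPow_abs.
  rewrite Rabs_inv, (Rabs_right (Tprod z j)) by lra.
  assert (H1 : / Tprod z j <= 2).
  { replace 2 with (/ (1 / 2)) by field. apply Rinv_le_contravar; lra. }
  assert (H2 : Rabs z ^ 2 ^ j <= Rabs z ^ S j)
    by (apply pow_le_anti; [lra | pose proof (lt_pow_two j); lia]).
  replace (2 * Rabs z * Rabs z ^ j) with (Rabs z ^ S j * 2) by (simpl; ring).
  apply Rmult_le_compat; auto.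
  - apply pow_le, Rabs_pos.
  - left; apply Rinv_0_lt_compat; lra.
Qed.

Lemma ex_series_Rabs_le (a b : nat -> R) :
  (forall n, Rabs (a n) <= b n) -> ex_series b -> ex_series a.
Proof. exact (@ex_series_le R_AbsRing R_CompleteNormedModule a b). Qed.

Lemma small_geom (z : R) : Rabs z <= 1 / 4 ->
  is_series (fun j => 2 * Rabs z * Rabs z ^ j) (2 * Rabs z * / (1 - Rabs z)).
Proof.
  intros Hz.
  apply (@is_series_scal R_AbsRing R_NormedModule (2 * Rabs z) (fun j => Rabs z ^ j)), is_series_geom.
  rewrite Rabs_Rabsolu. lra.
Qed.

Lemma ex_series_M_small (z : R) : Rabs z <= 1 / 4 -> ex_series (M_term z).
Proof.
  intros Hz. apply ex_series_Rabs_le with (b := fun j => 2 * Rabs z * Rabs z ^ j).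
  - intros n. apply M_term_small, Hz.
  - eexists; apply small_geom, Hz.
Qed.

Lemma M_small (z : R) : Rabs z <= 1 / 4 -> Rabs (M z) <= 4 * Rabs z.
Proof.
  intros Hz. unfold M. pose proof (Rabs_pos z).
  assert (Ha : ex_series (fun n => Rabs (M_term z n))).
  { apply ex_series_Rabs_le with (b := fun j => 2 * Rabs z * Rabs z ^ j).
    - intros n. rewrite Rabs_Rabsolu. apply M_term_small, Hz.
    - eexists; apply small_geom, Hz. }
  eapply Rle_trans; [apply Series_Rabs, Ha|].
  eapply Rle_trans.
  - apply Series_le with (b := fun j => 2 * Rabs z * Rabs z ^ j).
    + intros n; split; [apply Rabs_pos | apply M_term_small, Hz].
    + eexists; apply small_geom, Hz.
  - rewrite (is_series_unique _ _ (small_geom z Hz)). apply Rle_div_l; nra.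
Qed.

(** Consecutive products differ by -[Tprod z j * z ^ 2 ^ j], so the sequence is 1 plus the partial
    sums of an absolutely convergent series. *)
Lemma ex_lim_Tprod_small (z : R) : Rabs z <= 1 / 4 -> ex_finite_lim_seq (Tprod z).
Proof.
  intros Hz. pose proof (Rabs_pos z).
  assert (Hs : ex_series (fun j => - (Tprod z j * z ^ 2 ^ j))).
  { apply ex_series_Rabs_le with (b := fun j => 2 * Rabs z * Rabs z ^ j).
    - intros j. pose proof (Tprod_bounds z j Hz).
      rewrite Rabs_Ropp, Rabs_mult, (Rabs_right (Tprod z j)), <- RPow_abs by lra.
      assert (H2 : Rabs z ^ 2 ^ j <= Rabs z ^ S j)
        by (apply pow_le_anti; [lra | pose proof (lt_pow_two j); lia]).
      replace (2 * Rabs z * Rabs z ^ j) with (2 * Rabs z ^ S j) by (simpl; ring).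
      apply Rmult_le_compat; try lra. apply pow_le, Rabs_pos.
    - eexists; apply small_geom, Hz. }
  destruct Hs as [l Hl].
  assert (Hl1 : is_lim_seq (sum_n (fun j => - (Tprod z j * z ^ 2 ^ j))) l) by exact Hl.
  exists (1 + l). apply is_lim_seq_incr_1.
  apply is_lim_seq_ext with (fun n => 1 + sum_n (fun j => - (Tprod z j * z ^ 2 ^ j)) n).
  - induction n as [|n IH].
    + rewrite sum_O. simpl; ring.
    + rewrite sum_Sn. unfold plus; simpl.
      change (Tprod z n * (1 - z ^ 2 ^ n)) with (Tprod z (S n)) in *.
      rewrite <- Rplus_assoc, IH. simpl; ring.
  - apply is_lim_seq_plus'; [apply is_lim_seq_const | exact Hl1].
Qed.

Lemma T_small (z : R) : Rabs z <= 1 / 4 -> Rabs (T z - 1) <= 2 * Rabs z.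
Proof.
  intros Hz. unfold T.
  pose proof (Lim_seq_correct' _ (ex_lim_Tprod_small z Hz)) as Hl.
  assert (Hl2 : is_lim_seq (fun n => Rabs (Tprod z n - 1)) (Rabs (real (Lim_seq (Tprod z)) - 1))).
  { apply (is_lim_seq_abs (fun n => Tprod z n - 1) (Finite _)).
    apply is_lim_seq_minus'; [exact Hl | apply is_lim_seq_const]. }
  apply (is_lim_seq_le (fun n => Rabs (Tprod z n - 1)) (fun _ => 2 * Rabs z) (Finite _) (Finite _)).
  - intros n. apply Tprod_sub1_small, Hz.
  - exact Hl2.
  - apply is_lim_seq_const.
Qed.

Lemma T_bounds (z : R) : Rabs z <= 1 / 4 -> 1 / 2 <= T z <= 3 / 2.
Proof.
  intros Hz. pose proof (T_small z Hz) as H. apply Rabs_le_between in H. lra.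
Qed.

(** * Convergence on the unit disc, functional equations and their iterates *)

Lemma M_term_sqr (z : R) (j : nat) : Rabs z < 1 ->
  M_term z (S j) = - / (1 - z) * M_term (z ^ 2) j.
Proof.
  intros Hz. unfold M_term. rewrite Tprod_sqr, <- pow_two_sqr.
  assert (Rabs (z ^ 2) < 1) by (apply Rabs_pow_lt1; auto).
  pose proof (Tprod_neq0 (z ^ 2) j H). pose proof (one_sub_pow_neq0 z 0 Hz).
  simpl pow in *. field. split; auto. lra.
Qed.

Lemma pow_two_small (z eps : R) : Rabs z < 1 -> 0 < eps ->
  exists K, forall k, (K <= k)%nat -> Rabs (z ^ 2 ^ k) <= eps.
Proof.
  intros Hz He. destruct (pow_lt_1_zero z Hz eps He) as [N HN].
  exists N. intros k Hk. left. apply HN. pose proof (lt_pow_two k). lia.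
Qed.

(** [Lim_seq] is total, so statements about T need actual convergence. The finite functional
    equation carries it from z^2 back to z, and repeated squaring reaches the disc of radius 1/4. *)
Lemma ex_lim_Tprod (z : R) : Rabs z < 1 -> ex_finite_lim_seq (Tprod z).
Proof.
  intros Hz. destruct (pow_two_small z (1 / 4) Hz) as [K HK]; [lra|].
  (* K counts the squarings still needed to enter the small disc; z is generalized because each step
     replaces it by z^2. *)
  specialize (HK K (le_n K)). revert z Hz HK. induction K as [|K IH]; intros z Hz HK.
  - apply ex_lim_Tprod_small. simpl in HK. now rewrite Rmult_1_r in HK.
  - destruct (IH (z ^ 2)) as [l Hl].
    + apply Rabs_pow_lt1; auto.
    + now rewrite pow_two_sqr.
    + exists ((1 - z) * l). apply is_lim_seq_incr_1.
      apply is_lim_seq_ext with (fun n => (1 - z) * Tprod (z ^ 2) n).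
      * intros n. now rewrite Tprod_sqr.
      * apply (is_lim_seq_scal_l _ (1 - z) (Finite l)), Hl.
Qed.

Lemma ex_series_M (z : R) : Rabs z < 1 -> ex_series (M_term z).
Proof.
  intros Hz. destruct (pow_two_small z (1 / 4) Hz) as [K HK]; [lra|].
  specialize (HK K (le_n K)). revert z Hz HK. induction K as [|K IH]; intros z Hz HK.
  - apply ex_series_M_small. simpl in HK. now rewrite Rmult_1_r in HK.
  - apply ex_series_incr_1.
    apply ex_series_ext with (fun j => scal (- / (1 - z)) (M_term (z ^ 2) j)).
    + intros j. now rewrite (M_term_sqr z j Hz).
    + apply (@ex_series_scal R_AbsRing R_NormedModule (- / (1 - z))), IH.
      * apply Rabs_pow_lt1; auto.
      * now rewrite pow_two_sqr.
Qed.

Lemma T_sqr (z : R) : Rabs z < 1 -> T z = (1 - z) * T (z ^ 2).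
Proof.
  intros Hz. unfold T. rewrite <- (Lim_seq_incr_1 (Tprod z)).
  rewrite (Lim_seq_ext _ (fun n => (1 - z) * Tprod (z ^ 2) n)) by (intros; apply Tprod_sqr).
  assert (Hz2 : Rabs (z ^ 2) < 1) by (apply Rabs_pow_lt1; auto).
  pose proof (Lim_seq_correct' _ (ex_lim_Tprod (z ^ 2) Hz2)) as Hl.
  rewrite (is_lim_seq_unique _ (Finite ((1 - z) * real (Lim_seq (Tprod (z ^ 2)))))); auto.
  apply (is_lim_seq_scal_l _ (1 - z) (Finite _)), Hl.
Qed.

(** The term j = 0 is z, and the remaining terms sum to -M(z^2) / (1 - z). *)
Lemma M_sqr (z : R) : Rabs z < 1 -> (1 - z) * M z = (1 - z) * z - M (z ^ 2).
Proof.
  intros Hz. unfold M. rewrite (Series_incr_1 (M_term z)) by now apply ex_series_M.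
  rewrite (Series_ext _ (fun j => - / (1 - z) * M_term (z ^ 2) j))
    by (intros; now apply M_term_sqr).
  rewrite Series_scal_l. pose proof (one_sub_pow_neq0 z 0 Hz) as H.
  simpl in H. unfold M_term at 1. simpl. field. lra.
Qed.

(* [Mnum z k / Tprod z k] is the [k]-th partial sum of the series defining [M z]. *)
Fixpoint Mnum (z : R) (k : nat) : R :=
  match k with
  | O => 0
  | S j => (1 - z ^ 2 ^ j) * (Mnum z j + (-1) ^ j * z ^ 2 ^ j)
  end.

Lemma T_iter (z : R) (k : nat) : Rabs z < 1 -> T z = Tprod z k * T (z ^ 2 ^ k).
Proof.
  intros Hz. induction k as [|k IH]; [simpl; rewrite !Rmult_1_r; ring|].
  rewrite IH, (T_sqr (z ^ 2 ^ k)), <- pow_two_S; [simpl; ring|].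
  apply Rabs_pow_lt1; auto. pose proof (lt_pow_two k); lia.
Qed.

(** Each squaring flips the sign of the tail. Multiplying by [Tprod z k] clears the denominators, so
    that only polynomial factors in z remain. *)
Lemma M_iter (z : R) (k : nat) : Rabs z < 1 ->
  Tprod z k * M z = Mnum z k + (-1) ^ k * M (z ^ 2 ^ k).
Proof.
  intros Hz. induction k as [|k IH]; [simpl; rewrite !Rmult_1_r; ring|].
  assert (Hw : Rabs (z ^ 2 ^ k) < 1).
  { apply Rabs_pow_lt1; auto. pose proof (lt_pow_two k); lia. }
  pose proof (M_sqr _ Hw) as Hs. rewrite <- pow_two_S in Hs.
  simpl Tprod; simpl Mnum.
  replace (Tprod z k * (1 - z ^ 2 ^ k) * M z)
    with ((1 - z ^ 2 ^ k) * (Tprod z k * M z)) by ring.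
  rewrite IH.
  replace ((1 - z ^ 2 ^ k) * (Mnum z k + (-1) ^ k * M (z ^ 2 ^ k)))
    with ((1 - z ^ 2 ^ k) * Mnum z k + (-1) ^ k * ((1 - z ^ 2 ^ k) * M (z ^ 2 ^ k))) by ring.
  rewrite Hs. change ((-1) ^ S k) with (-1 * (-1) ^ k). ring.
Qed.

(** * Integer polynomials as coefficient lists, constant term first *)

Fixpoint peval (p : list Z) (w : R) : R :=
  match p with
  | [] => 0
  | c :: p' => IZR c + w * peval p' w
  end.

Fixpoint padd (p q : list Z) : list Z :=
  match p, q with
  | [], _ => q
  | _, [] => p
  | c :: p', d :: q' => (c + d)%Z :: padd p' q'
  end.

Fixpoint pmul (p q : list Z) : list Z :=
  match p with
  | [] => []
  | c :: p' => padd (map (Z.mul c) q) (0%Z :: pmul p' q)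
  end.

Definition pmonom (c : Z) (n : nat) : list Z := repeat 0%Z n ++ [c].

Lemma peval_padd (p q : list Z) (w : R) : peval (padd p q) w = peval p w + peval q w.
Proof.
  revert q; induction p as [|c p IH]; intros [|d q]; simpl; try ring.
  rewrite IH, plus_IZR. ring.
Qed.

Lemma peval_scal (c : Z) (p : list Z) (w : R) : peval (map (Z.mul c) p) w = IZR c * peval p w.
Proof. induction p as [|d p IH]; simpl; [ring|]. rewrite IH, mult_IZR. ring. Qed.

Lemma peval_pmul (p q : list Z) (w : R) : peval (pmul p q) w = peval p w * peval q w.
Proof.
  induction p as [|c p IH]; simpl; [ring|].
  rewrite peval_padd, peval_scal. simpl. rewrite IH. ring.
Qed.

Lemma peval_zeros_app (n : nat) (p : list Z) (w : R) :
  peval (repeat 0%Z n ++ p) w = w ^ n * peval p w.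
Proof. induction n as [|n IH]; simpl; [ring|]. rewrite IH. ring. Qed.

Lemma peval_pmonom (c : Z) (n : nat) (w : R) : peval (pmonom c n) w = IZR c * w ^ n.
Proof. unfold pmonom. rewrite peval_zeros_app. simpl. ring. Qed.

Lemma peval_bounded (p : list Z) :
  exists K, 0 < K /\ forall w, Rabs w <= 1 -> Rabs (peval p w) <= K.
Proof.
  induction p as [|c p [K [HK IH]]].
  - exists 1. split; [lra|]. intros w _. simpl. rewrite Rabs_R0. lra.
  - exists (Rabs (IZR c) + K). pose proof (Rabs_pos (IZR c)). split; [lra|].
    intros w Hw. simpl. eapply Rle_trans; [apply Rabs_triang|].
    rewrite Rabs_mult. specialize (IH w Hw).
    pose proof (Rabs_pos w). pose proof (Rabs_pos (peval p w)). nra.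
Qed.

(** List versions of [Tprod] and, below, of [Mnum], so that orders of vanishing can be decided by
    computation on coefficients. *)
Fixpoint Tpoly (k : nat) : list Z :=
  match k with
  | O => [1%Z]
  | S j => pmul (Tpoly j) (padd [1%Z] (pmonom (-1) (2 ^ j)))
  end.

Fixpoint Mpoly (k : nat) : list Z :=
  match k with
  | O => []
  | S j => pmul (padd [1%Z] (pmonom (-1) (2 ^ j)))
                (padd (Mpoly j) (pmonom ((-1) ^ Z.of_nat j) (2 ^ j)))
  end.

Lemma peval_Tpoly (k : nat) (w : R) : peval (Tpoly k) w = Tprod w k.
Proof.
  induction k as [|k IH]; [simpl; ring|]. cbn [Tpoly Tprod].
  rewrite peval_pmul, peval_padd, peval_pmonom, IH. simpl. ring.
Qed.

Lemma peval_Mpoly (k : nat) (w : R) : peval (Mpoly k) w = Mnum w k.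
Proof.
  induction k as [|k IH]; [reflexivity|]. cbn [Mpoly Mnum].
  rewrite peval_pmul, !peval_padd, !peval_pmonom, IH, <- pow_IZR. simpl. ring.
Qed.

(** * Linear forms in 1, T, M and their order of vanishing at 0 *)

Definition lform (A B C : list Z) (w : R) : R := peval A w + peval B w * T w + peval C w * M w.

(* A polynomial equal to [Tprod w j * lform A B C w] up to [O(w ^ 2 ^ j)]. *)
Definition lform_trunc (j : nat) (A B C : list Z) : list Z :=
  padd (pmul A (Tpoly j)) (padd (pmul B (pmul (Tpoly j) (Tpoly j))) (pmul C (Mpoly j))).

(** Substituting the iterated functional equations isolates everything transcendental in T(u) - 1
    and M(u) with u = w^(2^j), both O(u). *)
Lemma lform_expand (j : nat) (A B C : list Z) (w : R) : Rabs w < 1 ->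
  Tprod w j * lform A B C w =
    peval (lform_trunc j A B C) w
    + (peval B w * (Tprod w j * Tprod w j) * (T (w ^ 2 ^ j) - 1)
       + peval C w * ((-1) ^ j * M (w ^ 2 ^ j))).
Proof.
  intros Hw. unfold lform, lform_trunc.
  rewrite !peval_padd, !peval_pmul, !peval_Tpoly, peval_Mpoly.
  pose proof (M_iter w j Hw) as HM. rewrite (T_iter w j Hw).
  replace (Tprod w j * (peval A w + peval B w * (Tprod w j * T (w ^ 2 ^ j)) + peval C w * M w))
    with (Tprod w j * peval A w + peval B w * (Tprod w j * Tprod w j) * T (w ^ 2 ^ j)
          + peval C w * (Tprod w j * M w)) by ring.
  rewrite HM. ring.
Qed.

(** Since v < 2^j, both the polynomial tail and the truncation error are O(|w|^(v+1)), so the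
    leading term c w^v decides the size for small w. *)
Lemma lform_order (j v : nat) (A B C E : list Z) (c : Z) :
  lform_trunc j A B C = repeat 0%Z v ++ c :: E -> c <> 0%Z -> (v < 2 ^ j)%nat ->
  exists K delta, 0 < K /\ 0 < delta /\
    forall w, Rabs w <= delta ->
      / K * Rabs w ^ v <= Rabs (lform A B C w) <= K * Rabs w ^ v.
Proof.
  intros Htr Hc Hv.
  destruct (peval_bounded B) as [KB [HKB HB]].
  destruct (peval_bounded C) as [KC [HKC HC]].
  destruct (peval_bounded E) as [KE [HKE HE]].
  (* Total error constant: tail E, then B with [Tprod] <= 3/2 twice and |T u - 1| <= 2|u|, then C
     with |M u| <= 4|u|. *)
  set (L := KE + KB * (3 / 2 * (3 / 2)) * 2 + KC * 4).
  assert (HL : 0 < L) by (unfold L; lra).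
  assert (Hc1 : 1 <= Rabs (IZR c)).
  { rewrite <- abs_IZR. apply IZR_le. lia. }
  set (c1 := Rabs (IZR c)) in *.
  assert (Hd : 0 < / (4 * L)) by (apply Rinv_0_lt_compat; lra).
  (* The radius makes the error at most |w|^v / 4, hence at most half the leading term since c1 >=
     1. Dividing by [Tprod] in [1/2, 3/2] leaves a value between c1/3 and 3 c1 times |w|^v, and c1/3
     >= 1/(3 c1). *)
  exists (3 * c1), (Rmin (1 / 4) (/ (4 * L))).
  split; [lra|]. split; [apply Rmin_glb_lt; lra|].
  intros w Hw.
  assert (Hw1 : Rabs w <= 1 / 4) by (eapply Rle_trans; [exact Hw | apply Rmin_l]).
  assert (Hw2 : Rabs w <= / (4 * L)) by (eapply Rle_trans; [exact Hw | apply Rmin_r]).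
  pose proof (Rabs_pos w) as Hw0.
  pose proof (lform_expand j A B C w ltac:(lra)) as Hexp.
  rewrite Htr, peval_zeros_app in Hexp. simpl peval in Hexp.
  set (u := w ^ 2 ^ j) in *.
  assert (Hu : Rabs u <= Rabs w * Rabs w ^ v).
  { unfold u. rewrite <- RPow_abs. change (Rabs w * Rabs w ^ v) with (Rabs w ^ S v).
    apply pow_le_anti; [lra | lia]. }
  pose proof (pow_le (Rabs w) v Hw0) as Hpv.
  assert (Hpv1 : Rabs w ^ v <= 1) by (rewrite <- (pow1 v); apply pow_incr; lra).
  assert (Hu4 : Rabs u <= 1 / 4) by nra.
  pose proof (Tprod_bounds w j Hw1) as HT.
  set (P := Tprod w j) in *.
  pose proof (T_small u Hu4) as HTu. pose proof (M_small u Hu4) as HMu.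
  assert (Hmain : Rabs (P * lform A B C w - IZR c * w ^ v) <= L * (Rabs w * Rabs w ^ v)).
  { rewrite Hexp.
    replace (w ^ v * (IZR c + w * peval E w) +
             (peval B w * (P * P) * (T u - 1) + peval C w * ((-1) ^ j * M u)) - IZR c * w ^ v)
      with (peval E w * (w * w ^ v)
            + (peval B w * (P * P) * (T u - 1) + peval C w * ((-1) ^ j * M u))) by ring.
    set (g := Rabs w * Rabs w ^ v) in *.
    assert (Hg : 0 <= g) by (apply Rmult_le_pos; auto).
    assert (H1 : Rabs (peval E w * (w * w ^ v)) <= KE * g).
    { rewrite Rabs_mult, (Rabs_mult w), <- RPow_abs.
      apply Rmult_le_compat_r; auto. apply HE; lra. }
    assert (H2 : Rabs (peval B w * (P * P) * (T u - 1)) <= KB * (3 / 2 * (3 / 2)) * (2 * g)).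
    { rewrite !Rabs_mult, (Rabs_right P) by lra.
      apply Rmult_le_compat; try apply Rabs_pos; try lra.
      - apply Rmult_le_pos; [apply Rabs_pos | nra].
      - apply Rmult_le_compat; try apply Rabs_pos; try nra. apply HB; lra. }
    assert (H3 : Rabs (peval C w * ((-1) ^ j * M u)) <= KC * (4 * g)).
    { rewrite Rabs_mult, (Rabs_mult ((-1) ^ j)), pow_1_abs, Rmult_1_l.
      apply Rmult_le_compat; try apply Rabs_pos; try lra. apply HC; lra. }
    eapply Rle_trans; [apply Rabs_triang|].
    eapply Rle_trans; [apply Rplus_le_compat_l, Rabs_triang|].
    unfold L. lra. }
  assert (HLw : L * Rabs w <= 1 / 4).
  { apply Rmult_le_compat_l with (r := L) in Hw2; [|lra].
    replace (L * / (4 * L)) with (1 / 4) in Hw2 by (field; lra). exact Hw2. }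
  assert (Hmain2 : Rabs (P * lform A B C w - IZR c * w ^ v) <= c1 / 2 * Rabs w ^ v).
  { eapply Rle_trans; [exact Hmain|]. rewrite <- Rmult_assoc.
    apply Rmult_le_compat_r; lra. }
  assert (Hcw : Rabs (IZR c * w ^ v) = c1 * Rabs w ^ v) by (rewrite Rabs_mult, <- RPow_abs; auto).
  pose proof (Rabs_triang_inv (P * lform A B C w) (IZR c * w ^ v)) as Ht1.
  pose proof (Rabs_triang_inv (IZR c * w ^ v) (P * lform A B C w)) as Ht2.
  rewrite (Rabs_minus_sym (IZR c * w ^ v)) in Ht2.
  rewrite Hcw in Ht1, Ht2. rewrite (Rabs_mult P), (Rabs_right P) in Ht1, Ht2 by lra.
  set (X := Rabs (lform A B C w)) in *.
  assert (HX : 0 <= X) by apply Rabs_pos.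
  split.
  - assert (/ (3 * c1) <= 1 / 3).
    { replace (1 / 3) with (/ 3) by field. apply Rinv_le_contravar; lra. }
    apply Rle_trans with (1 / 3 * Rabs w ^ v); [apply Rmult_le_compat_r; lra | nra].
  - nra.
Qed.

(* Padé-type forms found by linear algebra on the power series of T and M; the index is the
   weight d, with deg A < d, deg B <= d, deg C < d - 1.  In the third one, order 52 and weight 18
   give v (1 - lam) - d = 2 (17 - 26 lam), which is where the bound of the theorem comes from. *)
Definition F2_A : list Z := [1; -1]%Z.
Definition F2_B : list Z := [-1; -2; -1]%Z.
Definition F2_C : list Z := [2]%Z.

Definition F7_A : list Z := [-2; 5; -7; -6; 24; 0; -18]%Z.
Definition F7_B : list Z := [2; 1; 0; -1; 2; 0; -2; -2]%Z.
Definition F7_C : list Z := [-4; 6; 8; -12; -4; 8]%Z.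

Definition F18_A : list Z :=
  [-1; -7; 1; -5; 12; 52; -37; -47; -6; -66; 79; 117; -12; 12; -43; -65; 6; 6]%Z.
Definition F18_B : list Z :=
  [1; 2; 8; 14; 15; 16; 13; 10; 7; 4; 11; 18; 17; 16; 11; 6; 1; -4; -2]%Z.
Definition F18_C : list Z :=
  [6; 0; 6; 0; -40; 0; 10; 0; 60; 0; -38; 0; -24; 0; 22; 0; 0]%Z.

(** Level 6 is enough: its truncation error has order 2^6 = 64, above the orders 8, 21 and 52 in
    use. *)
Definition has_order (A B C : list Z) (v : nat) : Prop :=
  exists (c : Z) (E : list Z), lform_trunc 6 A B C = repeat 0%Z v ++ c :: E /\ c <> 0%Z.

Lemma has_order_of_check (A B C : list Z) (v : nat) :
  (forallb (Z.eqb 0) (firstn v (lform_trunc 6 A B C))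
   && (Nat.ltb v (length (lform_trunc 6 A B C)))
   && negb (Z.eqb 0 (nth v (lform_trunc 6 A B C) 0%Z)))%bool = true ->
  has_order A B C v.
Proof.
  unfold has_order. generalize (lform_trunc 6 A B C). intros l.
  rewrite !Bool.andb_true_iff, Bool.negb_true_iff, Nat.ltb_lt, Z.eqb_neq.
  intros [[H1 H2] H3].
  exists (nth v l 0%Z), (skipn (S v) l). split; [|congruence].
  revert l H1 H2 H3. induction v as [|v IH]; intros [|x l] H1 H2 H3; simpl in *; try lia.
  - reflexivity.
  - apply andb_prop in H1. destruct H1 as [Hx H1]. destruct x; try discriminate.
    f_equal. apply IH; auto. lia.
Qed.

Lemma F2_order : has_order F2_A F2_B F2_C 8.
Proof. apply has_order_of_check. vm_compute. reflexivity. Qed.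

Lemma F7_order : has_order F7_A F7_B F7_C 21.
Proof. apply has_order_of_check. vm_compute. reflexivity. Qed.

Lemma F18_order : has_order F18_A F18_B F18_C 52.
Proof. apply has_order_of_check. vm_compute. reflexivity. Qed.

(** * Clearing denominators at rational points *)

Definition is_int (r : R) : Prop := exists n : Z, r = IZR n.

Lemma is_int_IZR (n : Z) : is_int (IZR n).
Proof. now exists n. Qed.

Lemma is_int_plus (r s : R) : is_int r -> is_int s -> is_int (r + s).
Proof. intros [m ->] [n ->]. exists (m + n)%Z. now rewrite plus_IZR. Qed.

Lemma is_int_mult (r s : R) : is_int r -> is_int s -> is_int (r * s).
Proof. intros [m ->] [n ->]. exists (m * n)%Z. now rewrite mult_IZR. Qed.

Lemma is_int_pow (r : R) (n : nat) : is_int r -> is_int (r ^ n).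
Proof.
  intros Hr. induction n as [|n IH]; simpl; [apply is_int_IZR | now apply is_int_mult].
Qed.

Lemma is_int_ge1 (r : R) : is_int r -> r <> 0 -> 1 <= Rabs r.
Proof.
  intros [n ->] Hn. rewrite <- abs_IZR. apply IZR_le.
  assert (n <> 0%Z) by (intros ->; now apply Hn). lia.
Qed.

Lemma peval_homog (p : list Z) (d : nat) (x y : R) : is_int x -> is_int y -> y <> 0 ->
  (length p <= S d)%nat -> is_int (y ^ d * peval p (x / y)).
Proof.
  intros Hx Hy Hy0. revert d. induction p as [|c p IH]; intros d Hd; simpl in *.
  - rewrite Rmult_0_r. apply is_int_IZR.
  - destruct d as [|d].
    + destruct p; [|simpl in Hd; lia]. simpl. rewrite Rmult_0_r, Rplus_0_r, Rmult_1_l.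
      apply is_int_IZR.
    + replace (y ^ S d * (IZR c + x / y * peval p (x / y)))
        with (y ^ S d * IZR c + x * (y ^ d * peval p (x / y))) by (simpl; field; auto).
      apply is_int_plus; apply is_int_mult; auto using is_int_pow, is_int_IZR.
      apply IH. lia.
Qed.

(** [Tprod] has degree 2^k - 1. The one spare factor y lets the clearing power simply square at each
    step. *)
Lemma Tprod_int (x y : R) (k : nat) : is_int x -> is_int y -> y <> 0 ->
  is_int (y ^ 2 ^ k * Tprod (x / y) k).
Proof.
  intros Hx Hy Hy0. induction k as [|k IH].
  - simpl. rewrite !Rmult_1_r. exact Hy.
  - rewrite pow_two_S. simpl Tprod.
    assert (Hyk : y ^ 2 ^ k <> 0) by now apply pow_nonzero.
    replace ((y ^ 2 ^ k) ^ 2 * (Tprod (x / y) k * (1 - (x / y) ^ 2 ^ k)))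
      with (y ^ 2 ^ k * Tprod (x / y) k * (y ^ 2 ^ k + IZR (-1) * x ^ 2 ^ k))
      by (unfold Rdiv; rewrite Rpow_mult_distr, pow_inv; field; auto).
    apply is_int_mult; auto. apply is_int_plus; [|apply is_int_mult];
      auto using is_int_pow, is_int_IZR.
Qed.

Lemma Mnum_int (x y : R) (k : nat) : is_int x -> is_int y -> y <> 0 ->
  is_int (y ^ 2 ^ k * Mnum (x / y) k).
Proof.
  intros Hx Hy Hy0. induction k as [|k IH].
  - simpl. rewrite Rmult_0_r. apply is_int_IZR.
  - rewrite pow_two_S. simpl Mnum.
    assert (Hyk : y ^ 2 ^ k <> 0) by now apply pow_nonzero.
    replace ((y ^ 2 ^ k) ^ 2 *
      ((1 - (x / y) ^ 2 ^ k) * (Mnum (x / y) k + (-1) ^ k * (x / y) ^ 2 ^ k)))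
      with ((y ^ 2 ^ k + IZR (-1) * x ^ 2 ^ k)
            * (y ^ 2 ^ k * Mnum (x / y) k + (-1) ^ k * x ^ 2 ^ k))
      by (unfold Rdiv; rewrite Rpow_mult_distr, pow_inv; field; auto).
    apply is_int_mult; apply is_int_plus; auto using is_int_pow;
      apply is_int_mult; auto using is_int_pow, is_int_IZR.
Qed.

(** * Forms in 1, T z, M z evaluated at a rational approximation *)

Lemma T_neq0 (z : R) : Rabs z < 1 -> T z <> 0.
Proof.
  intros Hz. destruct (pow_two_small z (1 / 4) Hz) as [K HK]; [lra|].
  rewrite (T_iter z K Hz). apply Rmult_integral_contrapositive_currified.
  - now apply Tprod_neq0.
  - pose proof (T_bounds _ (HK K (le_n K))). lra.
Qed.

Lemma Tprod_le (z : R) (k : nat) : Rabs z < 1 -> Rabs (Tprod z k) <= / (1 - Rabs z).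
Proof.
  intros Hz. pose proof (Tprod_sub1 z k Hz) as H.
  replace (Tprod z k) with ((Tprod z k - 1) + 1) by ring.
  eapply Rle_trans; [apply Rabs_triang|]. rewrite Rabs_R1.
  replace (/ (1 - Rabs z)) with (Rabs z / (1 - Rabs z) + 1) by (field; lra). lra.
Qed.

(** [Tprod z k] is T z / T(z^(2^k)) with denominator at most 3/2. As T z is nonzero, this bounds the
    products away from 0 uniformly in k. *)
Lemma Tprod_ge (z : R) (k : nat) : Rabs z < 1 -> Rabs (z ^ 2 ^ k) <= 1 / 4 ->
  Rabs (T z) / 2 <= Rabs (Tprod z k).
Proof.
  intros Hz Hk. rewrite (T_iter z k Hz), Rabs_mult.
  pose proof (T_bounds _ Hk). rewrite (Rabs_right (T (z ^ 2 ^ k))) by lra.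
  pose proof (Rabs_pos (Tprod z k)). nra.
Qed.

(* The form [lform A B C] at [z ^ 2 ^ k], rewritten through the functional equations as
   a form in [1, T z, M z]. *)
Lemma lform_iter (A B C : list Z) (z : R) (k : nat) : Rabs z < 1 ->
  Tprod z k * lform A B C (z ^ 2 ^ k) =
    (peval A (z ^ 2 ^ k) * Tprod z k
     - (-1) ^ k * peval C (z ^ 2 ^ k) * Tprod z k * Mnum z k)
    + peval B (z ^ 2 ^ k) * T z
    + (-1) ^ k * peval C (z ^ 2 ^ k) * Tprod z k * Tprod z k * M z.
Proof.
  intros Hz. unfold lform. rewrite (T_iter z k Hz).
  assert (Hs : (-1) ^ k * (-1) ^ k = 1).
  { rewrite <- pow_add. replace (k + k)%nat with (2 * k)%nat by lia. apply pow_1_even. }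
  replace (M (z ^ 2 ^ k)) with ((-1) ^ k * (Tprod z k * M z - Mnum z k)).
  - ring.
  - rewrite (M_iter z k Hz).
    replace ((-1) ^ k * (Mnum z k + (-1) ^ k * M (z ^ 2 ^ k) - Mnum z k))
      with ((-1) ^ k * (-1) ^ k * M (z ^ 2 ^ k)) by ring.
    rewrite Hs. ring.
Qed.

(** The alternatives are the vanishing and non-vanishing of an integer obtained by putting p1/q,
    p2/q for T z, M z in the transported form. The constants are uniform in k, q and eta, as later
    arguments let k follow q. *)
Lemma lform_dichotomy (A B C : list Z) (d v : nat) (a b : Z) :
  (2 <= d)%nat -> (length A <= d)%nat -> (length B <= S d)%nat -> (S (length C) <= d)%nat ->
  has_order A B C v -> (v < 64)%nat -> b <> 0%Z ->
  let z := IZR a / IZR b in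
  Rabs z < 1 ->
  exists K L, 0 < L /\
    forall k, (K <= k)%nat -> forall (p1 p2 q : Z) (eta : R), (1 <= q)%Z ->
      Rabs (T z - IZR p1 / IZR q) <= eta -> Rabs (M z - IZR p2 / IZR q) <= eta ->
      Rabs z ^ (2 ^ k * v) <= L * eta \/
      1 <= L * Rabs (IZR b) ^ (2 ^ k * d) * IZR q * (Rabs z ^ (2 ^ k * v) + eta).
Proof.
  intros Hd HA HB HC [c [E [Htr Hc]]] Hv Hb z Hz.
  destruct (lform_order 6 v A B C E c Htr Hc Hv) as [K0 [delta [HK0 [Hdelta Hord]]]].
  destruct (peval_bounded B) as [KB [HKB HBb]].
  destruct (peval_bounded C) as [KC [HKC HCb]].
  destruct (pow_two_small z (Rmin (1 / 4) delta) Hz) as [K HK].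
  { apply Rmin_glb_lt; lra. }
  assert (Hb0 : IZR b <> 0) by now apply eq_IZR_contrapositive.
  pose proof (T_neq0 z Hz) as HT0. pose proof (Rabs_pos_lt _ HT0) as HTp.
  set (P := / (1 - Rabs z)).
  assert (HP : 0 < P) by (apply Rinv_0_lt_compat; lra).
  (* Bounds the coefficients of both T z and M z, uniformly in k. *)
  set (H := KB + KC * P * P).
  assert (HKCP : 0 < KC * P * P) by (repeat apply Rmult_lt_0_compat; auto).
  assert (HH : 0 < H) by (unfold H; lra).
  set (c0 := Rabs (T z) / 2 * / K0).
  assert (Hc0 : 0 < c0) by (apply Rmult_lt_0_compat; [lra | now apply Rinv_0_lt_compat]).
  assert (HPK : 0 < P * K0) by now apply Rmult_lt_0_compat.
  assert (HHc : 0 < 2 * H / c0) by (apply Rdiv_lt_0_compat; lra).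
  (* The first summand serves the vanishing case; the other two bound the form's value and the
     approximation error in the non-vanishing case. *)
  exists K, (2 * H / c0 + P * K0 + 2 * H). split; [lra|].
  intros k Hk p1 p2 q eta Hq He1 He2.
  specialize (HK k Hk).
  assert (Hw1 : Rabs (z ^ 2 ^ k) <= 1 / 4) by (eapply Rle_trans; [exact HK | apply Rmin_l]).
  assert (Hw2 : Rabs (z ^ 2 ^ k) <= delta) by (eapply Rle_trans; [exact HK | apply Rmin_r]).
  specialize (Hord _ Hw2). destruct Hord as [Hlo Hhi].
  rewrite <- RPow_abs, <- pow_mult in Hlo, Hhi.
  pose proof (lform_iter A B C z k Hz) as Hit.
  pose proof (Tprod_le z k Hz) as HPk. fold P in HPk.
  pose proof (Tprod_ge z k Hz Hw1) as HPl.
  pose proof (Tprod_int (IZR a) (IZR b) k (is_int_IZR a) (is_int_IZR b) Hb0) as HTi.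
  pose proof (Mnum_int (IZR a) (IZR b) k (is_int_IZR a) (is_int_IZR b) Hb0) as HMi.
  fold z in HTi, HMi.
  set (w := z ^ 2 ^ k) in *. set (y := IZR b ^ 2 ^ k) in *.
  assert (Hy0 : y <> 0) by now apply pow_nonzero.
  assert (Hyi : is_int y) by apply is_int_pow, is_int_IZR.
  assert (Hwy : w = IZR a ^ 2 ^ k / y).
  { unfold w, z, y, Rdiv. now rewrite Rpow_mult_distr, pow_inv. }
  assert (Hxi : is_int (IZR a ^ 2 ^ k)) by apply is_int_pow, is_int_IZR.
  set (Tk := Tprod z k) in *. set (Mk := Mnum z k) in *. set (s := (-1) ^ k) in *.
  assert (Hsi : is_int s) by apply is_int_pow, is_int_IZR.
  set (a0 := peval A w * Tk - s * peval C w * Tk * Mk) in *.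
  set (b0 := peval B w) in *. set (c1 := s * peval C w * Tk * Tk) in *.
  assert (Hb0H : Rabs b0 <= H).
  { apply Rle_trans with KB; [apply HBb; lra|].
    unfold H. lra. }
  assert (Hc1H : Rabs c1 <= H).
  { unfold c1, s. rewrite !Rabs_mult, pow_1_abs, Rmult_1_l.
    apply Rle_trans with (KC * P * P); [|unfold H; lra].
    pose proof (Rabs_pos Tk).
    apply Rmult_le_compat; auto; [apply Rmult_le_pos; auto using Rabs_pos|].
    apply Rmult_le_compat; auto using Rabs_pos. apply HCb; lra. }
  assert (Hint : is_int (y ^ d * (a0 * IZR q + b0 * IZR p1 + c1 * IZR p2))).
  { destruct d as [|[|d]]; [lia|lia|].
      assert (HAi : is_int (y ^ S d * peval A w)) by (rewrite Hwy; apply peval_homog; auto).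
      assert (HBi : is_int (y ^ S (S d) * b0))
        by (unfold b0; rewrite Hwy; apply peval_homog; auto).
      assert (HCi : is_int (y ^ d * peval C w))
        by (rewrite Hwy; apply peval_homog; auto; lia).
      replace (y ^ S (S d) * (a0 * IZR q + b0 * IZR p1 + c1 * IZR p2))
        with ((y ^ S d * peval A w * (y * Tk)
               + IZR (-1) * (s * (y ^ d * peval C w) * (y * Tk) * (y * Mk))) * IZR q
              + y ^ S (S d) * b0 * IZR p1
              + s * (y ^ d * peval C w) * (y * Tk) * (y * Tk) * IZR p2)
        by (unfold a0, c1; simpl; ring).
      auto 10 using is_int_plus, is_int_mult, is_int_IZR. }
  assert (Hq1 : 1 <= IZR q) by now apply IZR_le.
  set (N := a0 * IZR q + b0 * IZR p1 + c1 * IZR p2) in *.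
  set (F := lform A B C w) in *.
  (* q times the form at the true values is its value N at the approximation plus q times a
     combination of the two errors. *)
  assert (HqF : IZR q * (Tk * F) = N + IZR q * (b0 * (T z - IZR p1 / IZR q)
                                               + c1 * (M z - IZR p2 / IZR q))).
  { rewrite Hit. unfold N. field. lra. }
  set (e := b0 * (T z - IZR p1 / IZR q) + c1 * (M z - IZR p2 / IZR q)) in *.
  assert (Heta : 0 <= eta) by (eapply Rle_trans; [apply Rabs_pos | exact He1]).
  assert (He : Rabs e <= 2 * H * eta).
  { unfold e. eapply Rle_trans; [apply Rabs_triang|]. rewrite !Rabs_mult.
    replace (2 * H * eta) with (H * eta + H * eta) by ring.
    apply Rplus_le_compat; apply Rmult_le_compat; auto using Rabs_pos. }
  set (g := Rabs z ^ (2 ^ k * v)) in *.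
  assert (Hg : 0 <= g) by apply pow_le, Rabs_pos.
  assert (HTF1 : c0 * g <= Rabs (Tk * F)).
  { unfold c0. rewrite Rabs_mult, Rmult_assoc. apply Rmult_le_compat; auto; try lra.
    apply Rmult_le_pos; auto. left; now apply Rinv_0_lt_compat. }
  assert (HTF2 : Rabs (Tk * F) <= P * K0 * g).
  { rewrite Rabs_mult, Rmult_assoc. apply Rmult_le_compat; auto using Rabs_pos. }
  destruct (Req_dec N 0) as [HN|HN].
  - left. rewrite HN, Rplus_0_l in HqF. apply Rmult_eq_reg_l in HqF; [|lra].
    rewrite HqF in HTF1.
    assert (g <= 2 * H / c0 * eta).
    { replace (2 * H / c0 * eta) with (2 * H * eta / c0) by (field; lra).
      apply Rle_div_r; lra. }
    pose proof (Rmult_le_pos (P * K0 + 2 * H) eta ltac:(lra) Heta). lra.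
  - right.
    assert (Hyd : y ^ d <> 0) by now apply pow_nonzero.
    pose proof (is_int_ge1 _ Hint ltac:(now apply Rmult_integral_contrapositive_currified)) as H1.
    rewrite Rabs_mult in H1.
    assert (Hyb : Rabs (y ^ d) = Rabs (IZR b) ^ (2 ^ k * d)).
    { unfold y. now rewrite <- !RPow_abs, pow_mult. }
    rewrite Hyb in H1. set (bb := Rabs (IZR b) ^ (2 ^ k * d)) in *.
    assert (Hbb : 0 <= bb) by apply pow_le, Rabs_pos.
    assert (HN2 : Rabs N <= IZR q * (P * K0 * g + 2 * H * eta)).
    { replace N with (IZR q * (Tk * F - e)) by (rewrite Rmult_minus_distr_l, HqF; ring).
      rewrite Rabs_mult, (Rabs_right (IZR q)) by lra.
      apply Rmult_le_compat_l; [lra|].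
      unfold Rminus. eapply Rle_trans; [apply Rabs_triang|]. rewrite Rabs_Ropp. lra. }
    eapply Rle_trans; [exact H1|].
    apply Rle_trans with (bb * (IZR q * (P * K0 * g + 2 * H * eta))).
    + now apply Rmult_le_compat_l.
    + rewrite <- !Rmult_assoc.
      replace ((2 * H / c0 + P * K0 + 2 * H) * bb * IZR q * (g + eta))
        with (bb * IZR q * ((2 * H / c0 + P * K0 + 2 * H) * (g + eta))) by ring.
      apply Rmult_le_compat_l; [apply Rmult_le_pos; lra|].
      assert (0 <= (2 * H / c0 + 2 * H) * g) by (apply Rmult_le_pos; lra).
      assert (0 <= (2 * H / c0 + P * K0) * eta) by (apply Rmult_le_pos; lra).
      lra.
Qed.

(** * Logarithmic scale and covering by excluded intervals *)

Lemma pow_two_bracket (W : R) : 1 <= W -> exists k, 2 ^ k <= W < 2 ^ S k.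
Proof.
  intros HW.
  destruct (Pow_x_infinity 2 ltac:(rewrite Rabs_right; lra) (W + 1)) as [N HN].
  specialize (HN N (le_n N)). rewrite Rabs_right in HN by (apply Rle_ge, pow_le; lra).
  assert (HWN : W < 2 ^ N) by lra. clear HN. induction N as [|N IH].
  - simpl in HWN. lra.
  - destruct (Rlt_le_dec W (2 ^ N)) as [H|H]; [now apply IH|]. now exists N.
Qed.

Lemma INR_pow_two_mult (k m : nat) : INR (2 ^ k * m) = 2 ^ k * INR m.
Proof. now rewrite mult_INR, pow_INR. Qed.

Lemma ln_pow_pos (x : R) (n : nat) : 0 < x -> ln (x ^ n) = INR n * ln x.
Proof. intros Hx. now rewrite <- Rpower_pow, ln_Rpower. Qed.

(** At the critical mu, (1 - lam)(mu - 1)/mu equals (15 - 6 lam)/32. So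
    [32 * INR d <= INR v * (15 - 6 * lam)] makes the case of a nonzero integer dominated by the
    error [eta] fall under the first alternative. *)
Lemma lform_log_dichotomy (A B C : list Z) (d v : nat) (a b : Z) (lam mu : R) :
  (2 <= d)%nat -> (length A <= d)%nat -> (length B <= S d)%nat -> (S (length C) <= d)%nat ->
  has_order A B C v -> (v < 64)%nat ->
  (2 <= b)%Z -> a <> 0%Z -> ln (Rabs (IZR a)) = lam * ln (IZR b) -> 0 <= lam -> lam < 1 / 2 ->
  32 * (1 - lam) / (17 - 26 * lam) < mu -> 32 * INR d <= INR v * (15 - 6 * lam) ->
  exists K c, 0 <= c /\ forall k, (K <= k)%nat -> forall (p1 p2 q : Z),
    approx_sol (T (IZR a / IZR b)) (M (IZR a / IZR b)) mu (p1, p2, q) ->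
    let Y := ln (IZR q) / ln (IZR b) in
    Y <= 2 ^ k * INR v * ((1 - lam) / mu) + c \/
    2 ^ k * (INR v * (1 - lam) - INR d) - c <= Y.
Proof.
  intros Hd HA HB HC Hord Hv Hb Ha Hlam Hl0 Hl1 Hmu Hdv.
  assert (Hb2 : 2 <= IZR b) by now apply IZR_le.
  assert (Ha0 : 0 < Rabs (IZR a)) by now apply Rabs_pos_lt, eq_IZR_contrapositive.
  set (z := IZR a / IZR b).
  assert (Hbeta : 0 < ln (IZR b)) by (rewrite <- ln_1; apply ln_increasing; lra).
  set (beta := ln (IZR b)) in *.
  assert (Hz : Rabs z = Rabs (IZR a) / IZR b).
  { unfold z, Rdiv. now rewrite Rabs_mult, Rabs_inv, (Rabs_right (IZR b)) by lra. }
  assert (Hz0 : 0 < Rabs z) by (rewrite Hz; apply Rdiv_lt_0_compat; lra).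
  assert (Hlnz : ln (Rabs z) = - (1 - lam) * beta).
  { rewrite Hz, ln_div by lra. rewrite Hlam. unfold beta. ring. }
  assert (Hz1 : Rabs z < 1).
  { apply ln_lt_inv; try lra. rewrite Hlnz, ln_1.
    pose proof (Rmult_lt_0_compat (1 - lam) beta ltac:(lra) Hbeta). lra. }
  destruct (lform_dichotomy A B C d v a b Hd HA HB HC Hord Hv ltac:(lia) Hz1)
    as [K [L [HL Hdich]]].
  assert (Hs : 0 < 17 - 26 * lam) by lra.
  assert (Hmu1 : 32 * (1 - lam) < mu * (17 - 26 * lam)) by (apply Rlt_div_l in Hmu; lra).
  assert (Hmu2 : 15 - 6 * lam < (mu - 1) * (17 - 26 * lam)) by lra.
  (* From 15 - 6 lam > 12 and 17 - 26 lam <= 17. As this exceeds 1/2, dividing by mu - 1 costs at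
     most a factor 2, whence the constant [2 * c]. *)
  assert (Hm1 : 12 / 17 <= mu - 1) by nra.
  set (c := (Rabs (ln L) + Rabs (ln (2 * L))) / beta).
  assert (Hc : 0 <= c).
  { apply Rdiv_le_0_compat; auto. pose proof (Rabs_pos (ln L)).
    pose proof (Rabs_pos (ln (2 * L))). lra. }
  assert (Hcb : c * beta = Rabs (ln L) + Rabs (ln (2 * L))) by (unfold c; field; lra).
  exists K, (2 * c). split; [lra|].
  intros k Hk p1 p2 q [Hq Hsol] Y.
  assert (Hq1 : 1 <= IZR q) by now apply IZR_le.
  assert (HY : ln (IZR q) = Y * beta) by (unfold Y, beta in *; field; lra).
  assert (HY0 : 0 <= Y).
  { apply Rdiv_le_0_compat; auto. rewrite <- ln_1. apply ln_le; lra. }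
  set (eta := Rpower (IZR q) (- mu)) in *.
  assert (Heta : 0 < eta) by apply exp_pos.
  assert (Hlneta : ln eta = - mu * (Y * beta)) by (unfold eta; rewrite ln_Rpower, HY; auto).
  assert (Hn : 0 < 2 ^ k) by (apply pow_lt; lra).
  pose proof (Rle_abs (ln L)). pose proof (Rle_abs (ln (2 * L))).
  pose proof (Rabs_pos (ln L)). pose proof (Rabs_pos (ln (2 * L))).
  set (g := Rabs z ^ (2 ^ k * v)) in *.
  assert (Hg : 0 < g) by now apply pow_lt.
  assert (Hlng : ln g = - (2 ^ k * INR v * (1 - lam)) * beta).
  { unfold g. rewrite ln_pow_pos, INR_pow_two_mult, Hlnz by auto. ring. }
  assert (Hinv : 2 ^ k * INR v * ((1 - lam) / mu) * mu = 2 ^ k * INR v * (1 - lam))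
    by (field; lra).
  destruct (Hdich k Hk p1 p2 q eta Hq) as [H3|H3].
  - eapply Rle_trans; [apply Rmax_l | left; apply Hsol].
  - eapply Rle_trans; [apply Rmax_r | left; apply Hsol].
  - left. change (g <= L * eta) in H3. apply ln_le in H3; auto. rewrite ln_mult, Hlng, Hlneta in H3 by auto.
    assert (H4 : mu * Y <= 2 ^ k * INR v * (1 - lam) + c).
    { apply Rmult_le_reg_r with beta; auto. lra. }
    apply Rmult_le_reg_r with mu; [lra|]. nra.
  - change (1 <= L * Rabs (IZR b) ^ (2 ^ k * d) * IZR q * (g + eta)) in H3.
    rewrite (Rabs_right (IZR b)) in H3 by lra.
    set (h := IZR b ^ (2 ^ k * d)) in *.
    assert (Hh : 0 < h) by (apply pow_lt; lra).
    assert (Hlnh : ln h = 2 ^ k * INR d * beta).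
    { unfold h. rewrite ln_pow_pos, INR_pow_two_mult by lra. reflexivity. }
    assert (Hpos : 0 < h * IZR q) by (apply Rmult_lt_0_compat; lra).
    (* One of the two summands carries at least half of the total. *)
    assert (H4 : 1 <= 2 * L * (h * IZR q) * g \/ 1 <= 2 * L * (h * IZR q) * eta) by lra.
    destruct H4 as [H4|H4]; apply ln_le in H4; try lra;
      rewrite ln_1, 2!ln_mult, (ln_mult h), Hlnh, HY in H4 by (auto; lra || nra).
    + right. rewrite Hlng in H4.
      apply Rmult_le_reg_r with beta; auto. lra.
    + left. rewrite Hlneta in H4.
      assert (H5 : (mu - 1) * Y <= 2 ^ k * INR d + c).
      { apply Rmult_le_reg_r with beta; auto. lra. }
      assert (H6 : INR d <= INR v * ((1 - lam) / mu) * (mu - 1)).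
      { replace (INR v * ((1 - lam) / mu) * (mu - 1)) with (INR v * (1 - lam) * (mu - 1) / mu)
          by (field; lra).
        apply Rle_div_r; [lra|].
        pose proof (pos_INR v) as Hv0.
        assert (H7 : 0 <= mu * (32 * (INR v * (1 - lam) - INR d) - INR v * (17 - 26 * lam)))
          by (apply Rmult_le_pos; lra).
        assert (H8 : 0 <= INR v * (mu * (17 - 26 * lam) - 32 * (1 - lam)))
          by (apply Rmult_le_pos; lra).
        lra. }
      apply Rmult_le_reg_l with (mu - 1); [lra|].
      apply Rmult_le_compat_l with (r := 2 ^ k) in H6; [|lra].
      assert (c <= (mu - 1) * (2 * c)) by nra.
      lra.
Qed.

(** For large q some level k puts Y = log_b q in an octave that the three forms exclude entirely. *)
Lemma approx_sol_bounded (a b : Z) (lam mu : R) :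
  (2 <= b)%Z -> a <> 0%Z -> ln (Rabs (IZR a)) = lam * ln (IZR b) -> 0 <= lam -> lam < 1 / 2 ->
  32 * (1 - lam) / (17 - 26 * lam) < mu ->
  exists Q, forall p1 p2 q : Z,
    approx_sol (T (IZR a / IZR b)) (M (IZR a / IZR b)) mu (p1, p2, q) -> IZR q <= Q.
Proof.
  intros Hb Ha Hlam Hl0 Hl1 Hmu.
  assert (Hform : forall A B C d v,
    (2 <= d)%nat -> (length A <= d)%nat -> (length B <= S d)%nat -> (S (length C) <= d)%nat ->
    has_order A B C v -> (v < 64)%nat -> 32 * INR d <= INR v * (15 - 6 * lam) -> _)
    by exact (fun A B C d v Hd HA HB HC Ho Hv Hdv =>
      lform_log_dichotomy A B C d v a b lam mu Hd HA HB HC Ho Hv Hb Ha Hlam Hl0 Hl1 Hmu Hdv).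
  destruct (Hform F2_A F2_B F2_C 2%nat 8%nat) as [K2 [c2 [Hc2 D2]]];
    try (simpl; lia); try (simpl; lra); [exact F2_order|].
  destruct (Hform F7_A F7_B F7_C 7%nat 21%nat) as [K7 [c7 [Hc7 D7]]];
    try (simpl; lia); try (simpl; lra); [exact F7_order|].
  destruct (Hform F18_A F18_B F18_C 18%nat 52%nat) as [K18 [c18 [Hc18 D18]]];
    try (simpl; lia); try (simpl; lra); [exact F18_order|].
  clear Hform.
  set (c := c2 + c7 + c18). set (K := (K2 + K7 + K18)%nat).
  set (s := 17 - 26 * lam). set (kap := (1 - lam) / mu) in *.
  assert (Hs : 0 < s) by (unfold s; lra).
  assert (Hmu0 : 0 < mu).
  { eapply Rlt_trans; [|exact Hmu]. apply Rdiv_lt_0_compat; fold s; lra. }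
  assert (Hkap : 0 < kap) by (apply Rdiv_lt_0_compat; lra).
  assert (Hks : 32 * kap < s).
  { apply Rlt_div_l in Hmu; [|exact Hs]. unfold kap.
    replace (32 * ((1 - lam) / mu)) with (32 * (1 - lam) / mu) by (field; lra).
    apply Rlt_div_l; unfold s; lra. }
  (* The midpoint of 32 kap and s leaves room for the additive constants at both ends of the octave
     from n kap' to 2 n kap', where n = 2^k. *)
  set (kap' := (32 * kap + s) / 2).
  assert (Hkap' : 0 < kap') by (unfold kap'; lra).
  (* Forces k >= K and makes 2^k exceed 2c/(s - 32 kap) and 16c; the outer factor 2 is there because
     N < 2^(k+1) is what the bracket yields. *)
  set (N := Rmax (2 ^ K) (2 * (2 * c / (s - 32 * kap) + 16 * c + 1))).
  assert (HN1 : 1 <= N).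
  { eapply Rle_trans; [|apply Rmax_l]. apply pow_R1_Rle. lra. }
  assert (Hbeta : 0 < ln (IZR b)).
  { rewrite <- ln_1. apply ln_increasing; [lra|]. apply IZR_lt. lia. }
  exists (exp (N * kap' * ln (IZR b))). intros p1 p2 q Hsol.
  assert (Hq1 : 1 <= IZR q) by (apply IZR_le; apply Hsol).
  apply Rnot_lt_le. intros Hlt.
  apply ln_increasing in Hlt; [|apply exp_pos]. rewrite ln_exp in Hlt.
  set (Y := ln (IZR q) / ln (IZR b)).
  assert (HY : N * kap' < Y) by exact (proj1 (Rlt_div_r _ _ _ Hbeta) Hlt).
  assert (HW : N < Y / kap') by exact (proj1 (Rlt_div_r _ _ _ Hkap') HY).
  destruct (pow_two_bracket (Y / kap')) as [k [Hk1 Hk2]]; [lra|].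
  assert (HkK : (K <= k)%nat).
  { apply Nat.nlt_ge. intros Hk. pose proof (Rmax_l (2 ^ K)
      (2 * (2 * c / (s - 32 * kap) + 16 * c + 1))) as Hm. fold N in Hm.
    pose proof (Rle_pow 2 (S k) K ltac:(lra) Hk). lra. }
  assert (HkN : 2 * c / (s - 32 * kap) + 16 * c + 1 < 2 ^ k).
  { pose proof (Rmax_r (2 ^ K) (2 * (2 * c / (s - 32 * kap) + 16 * c + 1))) as Hm.
    fold N in Hm. simpl in Hk2. lra. }
  apply (Rle_div_r _ _ _ Hkap') in Hk1.
  apply (Rlt_div_l _ _ _ Hkap') in Hk2.
  specialize (D2 (S (S k)) ltac:(unfold K in HkK; lia) p1 p2 q Hsol).
  specialize (D7 (S k) ltac:(unfold K in HkK; lia) p1 p2 q Hsol).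
  specialize (D18 k ltac:(unfold K in HkK; lia) p1 p2 q Hsol).
  fold Y in D2, D7, D18. rewrite !INR_IZR_INZ in D2, D7, D18.
  set (n := 2 ^ k) in *.
  change (2 ^ S k) with (2 * n) in *. change (2 ^ S (S k)) with (2 * (2 * n)) in *.
  simpl IZR in D2, D7, D18.
  assert (Hcs : 0 <= 2 * c / (s - 32 * kap)) by (apply Rdiv_le_0_compat; unfold c; lra).
  assert (Hns : 2 * c < n * (s - 32 * kap)).
  { apply Rlt_div_l; [lra|]. unfold c in *; lra. }
  assert (Hnc : 16 * c < n) by lra.
  assert (Hn : 0 < n) by (unfold c in *; lra).
  assert (Hnl : 0 <= n * lam) by (apply Rmult_le_pos; lra).
  assert (Hnl2 : 0 <= n * (1 / 2 - lam)) by (apply Rmult_le_pos; lra).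
  unfold kap', s, c in *.
  (* Each first alternative contradicts the lower bound in force, at first Y >= n kap'. The second
     ones raise it to n(24 - 32 lam) - c, then n(28 - 42 lam) - c, then 2 n s - c, which exceeds 2 n
     kap'. The first alternatives stay below n s + c, (21/16) n s + c and (13/8) n s + c, as 32 kap
     < s. *)
  destruct D2 as [D2|D2]; [lra|]. destruct D7 as [D7|D7]; [lra|].
  destruct D18 as [D18|D18]; lra.
Qed.

(** * From bounded denominators to the exponent *)

Lemma bounded_Z_list (n : nat) :
  exists l : list Z, forall p : Z, (Z.abs p <= Z.of_nat n)%Z -> In p l.
Proof.
  exists (map (fun i => Z.of_nat i - Z.of_nat n)%Z (seq 0 (2 * n + 1))). intros p Hp.
  apply in_map_iff. exists (Z.to_nat (p + Z.of_nat n)). split; [lia|].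
  apply in_seq. lia.
Qed.

Lemma IZR_bounded_list (x : R) :
  exists l : list Z, forall p : Z, Rabs (IZR p) <= x -> In p l.
Proof.
  destruct (bounded_Z_list (Z.to_nat (up x))) as [l Hl]. exists l. intros p Hp.
  apply Hl. rewrite <- abs_IZR in Hp. destruct (archimed x) as [Hx _].
  assert (Z.abs p < up x)%Z by (apply lt_IZR; lra). lia.
Qed.

Lemma numerator_bound (alpha eta : R) (p q : Z) : (1 <= q)%Z -> eta <= 1 ->
  Rabs (alpha - IZR p / IZR q) < eta -> Rabs (IZR p) <= IZR q * (Rabs alpha + 1).
Proof.
  intros Hq He H. assert (Hq1 : 1 <= IZR q) by now apply IZR_le.
  replace (IZR p) with (IZR q * (alpha - (alpha - IZR p / IZR q))) by (field; lra).
  rewrite Rabs_mult, (Rabs_right (IZR q)) by lra. apply Rmult_le_compat_l; [lra|].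
  unfold Rminus at 1. eapply Rle_trans; [apply Rabs_triang|]. rewrite Rabs_Ropp. lra.
Qed.

(** As mu >= 0 and q >= 1, the errors are below 1, so a bound on q also bounds both numerators. *)
Lemma finite_sols_of_bounded (alpha1 alpha2 mu Q : R) : 0 <= mu ->
  (forall p1 p2 q : Z, approx_sol alpha1 alpha2 mu (p1, p2, q) -> IZR q <= Q) ->
  ~ infinitely_many_sols alpha1 alpha2 mu.
Proof.
  intros Hmu HQ Hinf. apply Hinf.
  destruct (IZR_bounded_list (Q * (Rabs alpha1 + 1))) as [l1 H1].
  destruct (IZR_bounded_list (Q * (Rabs alpha2 + 1))) as [l2 H2].
  destruct (IZR_bounded_list Q) as [l3 H3].
  exists (list_prod (list_prod l1 l2) l3). intros [[p1 p2] q] Hsol.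
  pose proof (HQ _ _ _ Hsol) as HqQ. destruct Hsol as [Hq Hsol].
  assert (Hq1 : 1 <= IZR q) by now apply IZR_le.
  assert (He : Rpower (IZR q) (- mu) <= 1).
  { rewrite <- (Rpower_O (IZR q)) by lra. apply Rle_Rpower; lra. }
  pose proof (Rabs_pos alpha1). pose proof (Rabs_pos alpha2).
  apply in_prod; [apply in_prod|].
  - apply H1. eapply Rle_trans.
    + eapply numerator_bound; [exact Hq | exact He |].
      eapply Rle_lt_trans; [apply Rmax_l | exact Hsol].
    + apply Rmult_le_compat_r; lra.
  - apply H2. eapply Rle_trans.
    + eapply numerator_bound; [exact Hq | exact He |].
      eapply Rle_lt_trans; [apply Rmax_r | exact Hsol].
    + apply Rmult_le_compat_r; lra.
  - apply H3. rewrite Rabs_right; lra.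
Qed.

Lemma sim_approx_exp_T_M (a b : Z) (lam : R) :
  (2 <= b)%Z -> a <> 0%Z -> ln (Rabs (IZR a)) = lam * ln (IZR b) -> 0 <= lam -> lam < 1 / 2 ->
  Rbar_le (sim_approx_exp (T (IZR a / IZR b)) (M (IZR a / IZR b)))
          (Finite (32 * (1 - lam) / (17 - 26 * lam))).
Proof.
  intros Hb Ha Hlam Hl0 Hl1. apply Lub_Rbar_correct. intros mu Hmu.
  apply Rnot_lt_le. intros Hlt.
  destruct (approx_sol_bounded a b lam mu Hb Ha Hlam Hl0 Hl1 Hlt) as [Q HQ].
  revert Hmu. apply (finite_sols_of_bounded _ _ _ Q); [|exact HQ].
  left. eapply Rlt_trans; [|exact Hlt]. apply Rdiv_lt_0_compat; lra.
Qed.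

Theorem theorem2 :
  (forall b : Z, (2 <= b)%Z ->
     Rbar_le (sim_approx_exp (T (1 / IZR b)) (M (1 / IZR b)))
             (Finite (32 / 17)))
  /\
  (forall (a b : Z) (lam : R),
     (2 <= b)%Z -> a <> 0%Z ->
     ln (Rabs (IZR a)) = lam * ln (IZR b) ->
     0 <= lam -> lam < 1 / 2 ->
     Rbar_le (sim_approx_exp (T (IZR a / IZR b)) (M (IZR a / IZR b)))
             (Finite (32 * (1 - lam) / (17 - 26 * lam)))).
Proof.
  split; [|exact sim_approx_exp_T_M].
  intros b Hb.
  (* The first claim is the case a = 1, lam = 0. *)
  replace (32 / 17) with (32 * (1 - 0) / (17 - 26 * 0)) by field.
  apply (sim_approx_exp_T_M 1 b 0); auto; try lia; try lra.
  rewrite Rabs_R1, ln_1. ring.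
Qed.
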